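(* Assume that the Laplacian matrix $\mathbf{L}\in\mathbb{R}^{n\times n}$ has the eigendecomposition $\mathbf{L}=\sum_{i=1}^n\lambda_i\mathbf{u}_i\mathbf{u}_i^\top$, with eigenvalues $\lambda_i\ge 0$ and eigenvectors $\mathbf{u}_i$ (the columns of an orthogonal matrix $\mathbf{U}$). Then the graph heat equation $$\frac{d\mathbf{X}_t}{dt}=-\mathbf{L}\mathbf{X}_t,\qquad \mathbf{X}_0=\mathbf{X},$$ admits a closed-form solution at time $t$, given by the heat kernel $$\mathbf{H}_t=e^{-t\mathbf{L}}=\sum_{i=1}^n e^{-\lambda_i t}\mathbf{u}_i\mathbf{u}_i^\top$$ (that is, $\mathbf{X}_t=\mathbf{H}_t\mathbf{X}$). As $t\to\infty$, $\mathbf{H}_t$ asymptotically converges to a non-informative equilibrium, due to the non-trivial (i.e., positive) eigenvalues vanishing, in the sense that $$\lim_{t\to\infty}e^{-\lambda_i t}=\begin{cases}0,&\text{if }\lambda_i>0,\\ 1,&\text{if }\lambda_i=0,\end{cases}\qquad i=1,\dots,n.$$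
   Context: $\mathcal{G}=(\mathcal{V},\mathbf{A})$ is a graph with $n$ nodes, where $\mathbf{A}=(a_{ij})\in\mathbb{R}^{n\times n}$ is its adjacency matrix and $a_{ij}$ is the edge weight between nodes $i$ and $j$. $\widetilde{\mathbf{A}}=\mathbf{A}+\mathbf{I}$ is the adjacency matrix augmented with self-loops, $\widetilde{\mathbf{D}}$ is the diagonal degree matrix of $\widetilde{\mathbf{A}}$ (its $i$-th diagonal entry is the $i$-th row sum of $\widetilde{\mathbf{A}}$), $\mathbf{S}=\widetilde{\mathbf{D}}^{-1/2}\widetilde{\mathbf{A}}\widetilde{\mathbf{D}}^{-1/2}$, and $\mathbf{L}=\widetilde{\mathbf{D}}^{-1/2}(\widetilde{\mathbf{D}}-\widetilde{\mathbf{A}})\widetilde{\mathbf{D}}^{-1/2}=\mathbf{I}-\mathbf{S}$ is the symmetrically normalized graph Laplacian of the augmented graph. $\mathbf{X}\in\mathbb{R}^{n\times d}$ is the matrix of input node features ($d$ features for each of the $n$ nodes), and $\mathbf{X}_t$ ($t\ge0$) denotes the features evolved to time $t$. The phrase ''non-informative equilibrium'' is informal; its precise content is the displayed limits. *)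

(* Defs.v *)
(* MathComp / MathComp-Analysis. *)
From HB Require Import structures.
From mathcomp Require Export all_boot all_order all_algebra.
From mathcomp Require Export all_classical all_reals all_analysis.

Set Implicit Arguments.
Unset Strict Implicit.
Unset Printing Implicit Defensive.

Import Order.TTheory GRing.Theory Num.Theory.
Import numFieldNormedType.Exports.

Local Open Scope classical_set_scope.
Local Open Scope ring_scope.

(* A weighted graph on the nodes 'I_n is given by its weight matrix. *)
Definition aug_adj (R : realType) (n : nat) (A : 'M[R]_n) : 'M[R]_n :=
  A + 1%:M.

Definition degree (R : realType) (n : nat) (A : 'M[R]_n) (i : 'I_n) : R :=
  \sum_j A i j.

Definition degree_mx (R : realType) (n : nat) (A : 'M[R]_n) : 'M[R]_n :=
  diag_mx (\row_i degree A i).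

(* The inverse square root of the degree matrix; meaningful only when all
   degrees are positive, since [Num.sqrt] vanishes on negative numbers and
   [0^-1 = 0]. *)
Definition degree_isqrt (R : realType) (n : nat) (A : 'M[R]_n) : 'M[R]_n :=
  diag_mx (\row_i (Num.sqrt (degree A i))^-1).

(* Symmetrically normalized Laplacian of the graph with added self-loops. *)
Definition laplacian (R : realType) (n : nat) (A : 'M[R]_n) : 'M[R]_n :=
  degree_isqrt (aug_adj A) *m (degree_mx (aug_adj A) - aug_adj A)
    *m degree_isqrt (aug_adj A).

(* The exponential series, summed in the (sup norm) topology of 'M[R]_n. *)
Definition expmx (R : realType) (n : nat) (M : 'M[R]_n) : 'M[R]_n :=
  limn (series (fun k : nat => (k`!%:R)^-1 *: M ^+ k)).

Definition heat_kernel (R : realType) (n : nat) (L : 'M[R]_n) (t : R)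
  : 'M[R]_n := expmx (- t *: L).

(* Time ranges over [0, +oo[: the values of [X] at negative times are
   irrelevant, and the derivative at time 0 is the right derivative. *)
Definition heat_solution (R : realType) (n d : nat) (L : 'M[R]_n)
    (X0 : 'M[R]_(n, d)) (X : R -> 'M[R]_(n, d)) : Prop :=
  [/\ X 0 = X0,
      h^-1 *: (X h - X 0) @[h --> 0^'+] --> - (L *m X 0)
    & forall t : R, 0 < t -> is_derive t 1 X (- (L *m X t))].

(* Main.v *)
Require Import Defs.
From mathcomp Require Import ring.
Import Order.TTheory GRing.Theory Num.Theory.
Import numFieldNormedType.Exports.
Local Open Scope classical_set_scope.
Local Open Scope ring_scope.

(* Since [U] is orthogonal, [L = U diag(lambda) U^T], so the powers of [L], and
   with them the exponential series, are computed eigenvalue by eigenvalue.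
   Likewise the matrix [U^T X_t] of spectral coefficients turns the heat equation
   into the decoupled scalar equations [y' = - lambda_i y], and
   [exp (lambda_i t) y] is constant by the mean value theorem. *)

Lemma sum_scale_col_projE (R : comNzRingType) (n : nat) (U : 'M[R]_n)
    (a : 'I_n -> R) :
  \sum_(i < n) a i *: (col i U *m (col i U)^T) =
  U *m diag_mx (\row_i a i) *m U^T.
Proof.
apply/matrixP => k l; rewrite summxE !mxE; apply: eq_bigr => i _.
rewrite mul_mx_diag !mxE big_ord1 !mxE mulrA.
by rewrite (mulrC (a i)).
Qed.

Lemma exp_conj_diag_mx (R : comNzRingType) (n : nat) (U : 'M[R]_n)
    (a : 'I_n -> R) (k : nat) :
  U^T *m U = 1%:M ->
  (U *m diag_mx (\row_i a i) *m U^T) ^+ k =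
  U *m diag_mx (\row_i a i ^+ k) *m U^T.
Proof.
move=> UTU; elim: k => [|k IH].
  (* The zeroth power requires [U *m U^T = 1%:M]; for square matrices it follows from the one-sided
     hypothesis. *)
  rewrite expr0 (_ : \row_i _ = const_mx 1).
    by rewrite diag_const_mx mulmx1 (mulmx1C UTU).
  by apply/rowP => i; rewrite !mxE.
rewrite exprS IH -[X in X = _]/(_ *m _) !mulmxA -(mulmxA _ U^T U) UTU mulmx1.
congr (_ *m _); rewrite -(mulmxA U); congr (_ *m _).
by rewrite mulmx_diag; congr diag_mx; apply/rowP => i; rewrite !mxE exprS.
Qed.

(** Each partial sum of the matrix series is a combination of the fixed projections whose
    coefficients are partial sums of scalar exponential series, so convergence reduces to the scalar
    case. *)
Lemma expmx_spectral (R : realType) (n : nat) (U : 'M[R]_n) (a : 'I_n -> R) :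
  U^T *m U = 1%:M ->
  expmx (\sum_(i < n) a i *: (col i U *m (col i U)^T)) =
  \sum_(i < n) expR (a i) *: (col i U *m (col i U)^T).
Proof.
move=> UTU; apply: cvg_lim; first exact: norm_hausdorff.
rewrite (_ : series _ = fun N => \sum_(i < n)
    series (exp_coeff (a i)) N *: (col i U *m (col i U)^T)); last first.
  apply/funext => N; rewrite /series /=.
  under [RHS]eq_bigr do rewrite scaler_suml.
  rewrite exchange_big/=; apply: eq_bigr => k _.
  rewrite sum_scale_col_projE exp_conj_diag_mx// -sum_scale_col_projE.
  rewrite scaler_sumr.
  by apply: eq_bigr => i _; rewrite scalerA/= mulrC.
apply: cvg_big => [|i _]; first exact: add_continuous.
by apply: cvgZr_tmp; exact: is_cvg_series_exp_coeff.
Qed.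

(** Linearity moves [phi] outside the difference quotient, and continuity moves it outside the
    limit. *)
Lemma is_derive_comp_linear (R : realFieldType) (V W W' : normedModType R)
    (phi : W -> W') (f : V -> W) (x v : V) (df : W) :
  linear phi -> continuous phi -> is_derive x v f df ->
  is_derive x v (phi \o f) (phi df).
Proof.
move=> lphi cphi [fx dfE].
have : h^-1 *: (((phi \o f) \o shift x) (h *: v) - (phi \o f) x) @[h --> 0^']
    --> phi df.
  rewrite -dfE [X in X @ _ --> _](_ : _ =
    phi \o (fun h => h^-1 *: ((f \o shift x) (h *: v) - f x))); last first.
    apply/funext => h /=.
    by rewrite (scalable_linear lphi) (additive_linear lphi).
  by apply: continuous_cvg; [exact: cphi|].
move=> quotient_cvg; split; first by apply/cvg_ex; exists (phi df).
by apply: cvg_lim => //; exact: norm_hausdorff.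
Qed.

(** Only right continuity is asked at 0, because a solution is arbitrary at negative times; this is
    all that the mean value theorem on [[0, t]] uses at its left end. *)
Lemma linear_ode_unique (R : realType) (l : R) (y : R -> R) :
  y h @[h --> 0^'+] --> y 0 ->
  (forall t : R, 0 < t -> is_derive t 1 y (- l * y t)) ->
  forall t : R, 0 <= t -> y t = expR (- l * t) * y 0.
Proof.
move=> y0 dy t; rewrite le_eqVlt => /predU1P[<-|t0].
  by rewrite mulr0 expR0 mul1r.
pose z x := expR (l * x) * y x.
have dexp (x : R) : is_derive x 1 (fun x => expR (l * x)) (l * expR (l * x)).
  by apply: is_derive_eq; rewrite /GRing.scale/= mulr1 mulrC.
have dz (x : R) : 0 < x -> is_derive x 1 z 0.
  move=> /dy dyx.
  apply: is_derive_eq (is_deriveM _ _) _.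
  by rewrite /GRing.scale/=; ring.
have [||c _] := @MVT_segment R z (fun=> 0) 0 t (ltW t0).
- by move=> x; rewrite in_itv/= => /andP[x0 _]; exact: dz.
- apply/continuous_within_itvP => //; split.
  + move=> x; rewrite in_itv/= => /andP[x0 _].
    apply: differentiable_continuous; apply/derivable1_diffP.
    by case: (dz _ x0).
  + apply: cvgM y0.
    apply: (@cvg_at_right_filter _ _ (fun x => expR (l * x))).
    apply: (@differentiable_continuous _ _ _ _ (fun x => expR (l * x))).
    by apply/derivable1_diffP; case: (dexp 0).
  + apply: cvg_at_left_filter.
    apply: differentiable_continuous; apply/derivable1_diffP.
    by case: (dz _ t0).
rewrite mul0r => /subr0_eq; rewrite /z mulr0 expR0 mul1r => <-.
by rewrite mulrA -expRD mulNr addNr expR0 mul1r.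
Qed.

Lemma mulmx_entry_continuous (R : realFieldType) (m n p : nat)
    (A : 'M[R]_(m, n)) (i : 'I_m) (j : 'I_p) :
  continuous (fun M : 'M[R]_(n, p) => (A *m M) i j).
Proof.
rewrite (_ : (fun M => _) = fun M : 'M[R]_(n, p) => \sum_k A i k * M k j);
  last by apply/funext => M; rewrite mxE.
apply: continuous_big => [|k _]; first exact: add_continuous.
move=> M; apply: (@cvgMl_tmp _ _ (nbhs M)); exact: coord_continuous.
Qed.

Lemma mulmx_entry_linear (R : comNzRingType) (m n p : nat)
    (A : 'M[R]_(m, n)) (i : 'I_m) (j : 'I_p) :
  linear (fun M : 'M[R]_(n, p) => (A *m M) i j : R^o).
Proof. by move=> a M N; rewrite mulmxDr -scalemxAr !mxE. Qed.

(** Each summand is a scalar exponential followed by the continuous linear map [b |-> b *: C i]. *)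
Lemma is_derive_sum_expR_scale (R : realType) (V : normedModType R) (n : nat)
    (a : 'I_n -> R) (C : 'I_n -> V) (t : R) :
  is_derive t 1 (fun t => \sum_(i < n) expR (a i * t) *: C i)
    (\sum_(i < n) (a i * expR (a i * t)) *: C i).
Proof.
rewrite (_ : (fun t => _) = \sum_(i < n) fun t => expR (a i * t) *: C i);
  last by apply/funext => u; rewrite fct_sumE.
apply: is_derive_sum => i.
apply: (@is_derive_comp_linear _ R R^o V (fun b => b *: C i)
  (fun t => expR (a i * t))).
- by move=> b u v; rewrite scalerDl scalerA.
- by move=> b; apply: cvgZr_tmp.
- by apply: is_derive_eq; rewrite /GRing.scale/= mulr1 mulrC.
Qed.

(** For [h > 0], [f h] is [h] times the difference quotient plus [f 0], and the product tends to
    [0 *: l]. This turns the right derivative of a solution at 0 into the continuity that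
    [linear_ode_unique] asks for. *)
Lemma right_derivable_right_continuous (R : realFieldType) (V : normedModType R)
    (f : R -> V) (l : V) :
  h^-1 *: (f h - f 0) @[h --> 0^'+] --> l -> f h @[h --> 0^'+] --> f 0.
Proof.
move=> dfl.
have id0 : h @[h --> (0 : R)^'+] --> (0 : R).
  by apply: cvg_at_right_filter; exact: cvg_id.
have : h *: (h^-1 *: (f h - f 0)) + f 0 @[h --> 0^'+] --> 0 *: l + f 0.
  by apply: cvgD; [exact: cvgZ | exact: cvg_cst].
rewrite scale0r add0r; apply: cvg_trans; apply: near_eq_cvg; near=> h.
by rewrite scalerA divff ?scale1r ?subrK// gt_eqF.
Unshelve. all: by end_near.
Qed.

Theorem theorem1 (R : realType) (n d : nat) (A : 'M[R]_n)
    (deg_gt0 : forall i : 'I_n, 0 < degree (aug_adj A) i)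
    (U : 'M[R]_n) (lambda : 'I_n -> R)
    (U_orthogonal : U^T *m U = 1%:M)
    (lambda_ge0 : forall i : 'I_n, 0 <= lambda i)
    (L_eigen : laplacian A =
       \sum_(i < n) lambda i *: (col i U *m (col i U)^T)) :
  [/\ forall t : R, 0 <= t ->
        heat_kernel (laplacian A) t =
          \sum_(i < n) expR (- lambda i * t) *: (col i U *m (col i U)^T),
      forall (X0 : 'M[R]_(n, d)) (X : R -> 'M[R]_(n, d)),
        heat_solution (laplacian A) X0 X <->
        (forall t : R, 0 <= t -> X t = heat_kernel (laplacian A) t *m X0)
    & forall i : 'I_n,
        (0 < lambda i ->
           expR (- lambda i * t) @[t --> +oo%R] --> (0 : R)) /\
        (lambda i = 0 ->
           expR (- lambda i * t) @[t --> +oo%R] --> (1 : R))].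
Proof.
set L := laplacian A.
have LE : L = U *m diag_mx (\row_i lambda i) *m U^T.
  by rewrite -sum_scale_col_projE.
have kernelE t : heat_kernel L t =
    \sum_(i < n) expR (- lambda i * t) *: (col i U *m (col i U)^T).
  rewrite /heat_kernel /L L_eigen scaler_sumr.
  under eq_bigr do rewrite scalerA.
  rewrite expmx_spectral//; apply: eq_bigr => i _.
  by rewrite mulNr mulNr mulrC.
split=> [t _|X0 X|i]; first exact: kernelE.
- pose F t := heat_kernel L t *m X0.
  have F0 : F 0 = X0.
    rewrite /F kernelE sum_scale_col_projE (_ : \row_i _ = const_mx 1).
      by rewrite diag_const_mx mulmx1 (mulmx1C U_orthogonal) mul1mx.
    by apply/rowP => i; rewrite !mxE mulr0 expR0.
  (* The spectral formula for the kernel holds for every real [t], so [F] has a two-sided derivative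
     even at 0; the right derivative there is a restriction of it. *)
  have dF (t : R) : is_derive t 1 F (- (L *m F t)).
    have FE u : F u =
        \sum_(i < n) expR (- lambda i * u) *: (col i U *m (col i U)^T *m X0).
      rewrite /F kernelE mulmx_suml.
      by apply: eq_bigr => i _; rewrite -scalemxAl.
    rewrite FE (funext FE).
    apply: (is_derive_eq (@is_derive_sum_expR_scale R _ n (fun i => - lambda i)
      (fun i => col i U *m (col i U)^T *m X0) t)).
    under eq_bigr do rewrite mulNr scaleNr scalemxAl.
    under [in RHS]eq_bigr do rewrite scalemxAl.
    rewrite sumrN -!mulmx_suml !sum_scale_col_projE LE !mulmxA.
    rewrite -(mulmxA _ U^T U) U_orthogonal mulmx1 -(mulmxA U) mulmx_diag.
    congr (- (_ *m diag_mx _ *m _ *m _)).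
    by apply/rowP => i; rewrite !mxE.
  have dF0 : h^-1 *: (F h - F 0) @[h --> 0^'+] --> - (L *m F 0).
    apply: cvg_dnbhs_at_right; have [F0d <-] := dF 0.
    rewrite [X in X @ _ --> _](_ : _ = fun h : R =>
      h^-1 *: ((F \o shift 0) (h *: 1) - F 0)); first exact: F0d.
    by apply/funext => h /=; rewrite addr0 /GRing.scale/= mulr1.
  split=> [[X0E dX0 dX]|XE].
  (* [U^T] is invertible, so comparing spectral coefficients is enough. *)
  + suff UX : forall t : R, 0 <= t -> U^T *m X t = U^T *m F t.
      move=> t t0.
      rewrite -[LHS]mul1mx -(mulmx1C U_orthogonal) -mulmxA UX// mulmxA.
      by rewrite (mulmx1C U_orthogonal) mul1mx.
    have UL (Y : 'M[R]_(n, d)) i j :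
        (U^T *m - (L *m Y)) i j = - lambda i * (U^T *m Y) i j.
      rewrite mulmxN LE !mulmxA U_orthogonal mul1mx -mulmxA mul_diag_mx !mxE.
      by rewrite mulNr.
    (* Stated for any [Y] so that it applies to both [X] and [F], whose coefficients then agree
       because their initial values do. *)
    have mode (Y : R -> 'M[R]_(n, d)) i j :
        h^-1 *: (Y h - Y 0) @[h --> 0^'+] --> - (L *m Y 0) ->
        (forall t : R, 0 < t -> is_derive t 1 Y (- (L *m Y t))) ->
        forall t : R, 0 <= t ->
          (U^T *m Y t) i j = expR (- lambda i * t) * (U^T *m Y 0) i j.
      move=> Y0 dY.
      have cU := @mulmx_entry_continuous R n n d U^T i j.
      apply: (@linear_ode_unique _ _ (fun t => (U^T *m Y t) i j)) => [|t t0].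
        apply: (continuous_cvg _ (cU (Y 0))).
        exact: right_derivable_right_continuous Y0.
      rewrite -UL.
      apply: (@is_derive_comp_linear _ R _ R^o
        (fun M : 'M[R]_(n, d) => (U^T *m M) i j) Y t 1 _ _ cU (dY t t0)).
      exact: mulmx_entry_linear.
    move=> t t0; apply/matrixP => i j; rewrite (mode X)// ?X0E//.
    by rewrite (mode F i j dF0 (fun u _ => dF u)) ?F0.
  (* [X] is known only at nonnegative times, so the limits pass from [F] to [X] by agreement on a
     right neighbourhood of 0, and on a full neighbourhood of each [t > 0]. *)
  + have X0E : X 0 = F 0 by exact: XE.
    split; first by rewrite X0E.
    * rewrite X0E; move: dF0; apply: cvg_trans; apply: near_eq_cvg; near=> h.
      by rewrite XE.
    * move=> t t0; rewrite XE ?ltW//.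
      apply: near_eq_is_derive (dF t); near=> u; rewrite XE//.
      by apply: ltW; near: u; exact: lt_nbhsr.
- split=> [l0|->].
  + under eq_fun do rewrite mulNr.
    apply: (cvg_comp _ _ _ (@cvgr_expR R)).
    apply: gt0_cvgMry l0 _; exact: cvg_id.
  + under eq_fun do rewrite oppr0 mul0r expR0.
    exact: cvg_cst.
Unshelve. all: by end_near.
Qed.
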